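(* If $R$ is a unital $QB$-ring, then the matrix ring $\mathbb M_n(R)$ is also a $QB$-ring for every natural number $n\ge1$.
   Context: Rings are associative. For elements $s,t$ of a unital ring $R$ write $s\perp t$ if $sRt=0$ and $tRs=0$. An element $u\in R$ is quasi-invertible, $u\in R_q^{-1}$, if there exist $c,d\in R$ with $(1-uc)\perp(1-du)$. A unital ring $R$ is a $QB$-ring if for all $a,b,x\in R$ with $xa+b=1$ there is $y\in R$ with $a+yb\in R_q^{-1}$. *)

(* Defs.v *)
From HB Require Import structures.
From mathcomp Require Import all_boot all_order all_algebra.

Set Implicit Arguments.
Unset Strict Implicit.
Unset Printing Implicit Defensive.

Import GRing.Theory.
Local Open Scope ring_scope.

(* Unital associative rings are [pzRingType]s, so that the zero ring is
   allowed and ['M[R]_n] is canonically a ring for a variable [n]. *)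

Definition ring_perp (R : pzRingType) (s t : R) : Prop :=
  (forall r : R, s * r * t = 0) /\ (forall r : R, t * r * s = 0).

Definition quasi_invertible (R : pzRingType) (u : R) : Prop :=
  exists c d : R, ring_perp (1 - u * c) (1 - d * u).

Definition QB_ring (R : pzRingType) : Prop :=
  forall a b x : R, x * a + b = 1 ->
    exists y : R, quasi_invertible (a + y * b).

(* Main.v *)
(* It suffices to pass from R to 2 x 2 matrices: iterating gives the sizes 2^k,
   and QB-rings are stable under corners.  Using the QB condition in R on the
   two columns of a unimodular pair (A, B), together with row and column
   operations, A is brought to the form
     [u, e b h; g c f, w]
   where u has quasi-inverse v, w has quasi-inverse z, and e = 1 - u v,
   f = 1 - v u, g = 1 - w z, h = 1 - z w.  The off-diagonal entries lie in the
   skew corners e R h and g R f.  Multiples of B allow one to replace them by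
   elements having quasi-inverses l and k in the opposite skew corners, that is,
   with defects e', h' and g', f' satisfying e' _|_ h' and g' _|_ f'.  Since
   e _|_ f and g _|_ h already hold, [v, k; l, z] is then a quasi-inverse. *)

Require Import Defs.
From HB Require Import structures.
From mathcomp Require Import all_boot all_order all_algebra.

Set Implicit Arguments.
Unset Strict Implicit.
Unset Printing Implicit Defensive.

Import GRing.Theory.
Local Open Scope ring_scope.

(** * Normalised quasi-inverses and their defects [e] and [f] *)

Record quasi_inverse (R : pzRingType) (u v e f : R) : Prop := QuasiInverse {
  qi_uv : u * v = 1 - e;
  qi_vu : v * u = 1 - f;
  qi_eu : e * u = 0;
  qi_uf : u * f = 0;
  qi_fv : f * v = 0;
  qi_ve : v * e = 0;
  qi_ef : forall x, e * x * f = 0;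
  qi_fe : forall x, f * x * e = 0 }.

Lemma mulr_tail (R : pzRingType) (a b c : R) :
  a * b = c -> forall x, x * a * b = x * c.
Proof. by move=> abc x; rewrite -mulrA abc. Qed.

Lemma ring_perpM (R : pzRingType) (s t x y x' y' : R) :
  ring_perp s t -> ring_perp (x * s * y) (x' * t * y').
Proof.
move=> [st ts]; split=> r.
  have -> : x * s * y * r * (x' * t * y') = x * (s * (y * r * x') * t) * y'.
    by rewrite !mulrA.
  by rewrite st mulr0 mul0r.
have -> : x' * t * y' * r * (x * s * y) = x' * (t * (y' * r * x) * s) * y.
  by rewrite !mulrA.
by rewrite ts mulr0 mul0r.
Qed.

(* The witness [(c + d - c u d) u (c + d - c u d)] is the usual normalisation
   making [u] and [v] inner inverses of each other. *)
Lemma quasi_inverseP (R : pzRingType) (u : R) :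
  quasi_invertible u -> exists v e f, quasi_inverse u v e f.
Proof.
case=> c [d cd]; set w := c + d - c * u * d.
(* This and the next factorisation put [1 - u * w] in [(1 - u * c) R] and [1 - w * u] in
   [R (1 - d * u)], so perpendicularity is inherited. *)
have uw : 1 - u * w = (1 - u * c) * (1 - u * d).
  rewrite /w [in RHS]mulrBl mul1r [in RHS]mulrBr mulr1 mulrBr mulrDr !mulrA.
  by rewrite !opprB !opprD !addrA [RHS](ACl (1*3*4*2))%AC.
have wu : 1 - w * u = (1 - c * u) * (1 - d * u).
  rewrite /w [in RHS]mulrBl mul1r [in RHS]mulrBr mulr1 mulrBl mulrDl !mulrA.
  by rewrite !opprB !opprD !addrA [RHS](ACl (1*3*4*2))%AC.
have uwu : u * w * u = u.
  apply/eqP; rewrite eq_sym -subr_eq0 -{1}[u]mul1r -mulrBl uw -mulrA.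
  (* Moving [u] to the left places it between [1 - u * c] and [1 - d * u], where every product
     vanishes. *)
  have -> : (1 - u * d) * u = u * (1 - d * u).
    by rewrite mulrBl mulrBr mul1r mulr1 mulrA.
  by rewrite mulrA cd.1.
have uvE : u * (w * u * w) = u * w by rewrite !mulrA uwu.
have vuE : w * u * w * u = w * u by rewrite -!mulrA (mulrA u) uwu.
have perp : ring_perp (1 - u * w) (1 - w * u).
  rewrite uw wu -[X in ring_perp X]mul1r mulrA -[X in ring_perp _ X]mulr1.
  exact: ring_perpM.
exists (w * u * w), (1 - u * w), (1 - w * u); split.
- by rewrite uvE subKr.
- by rewrite vuE subKr.
- by rewrite mulrBl mul1r uwu subrr.
- by rewrite mulrBr mulr1 mulrA uwu subrr.
- by rewrite mulrBl mul1r -!mulrA (mulrA u w (u * _)) (mulrA (u * w)) uwu subrr.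
- by rewrite mulrBr mulr1 -!mulrA (mulrA u w (u * _)) (mulrA (u * w)) uwu subrr.
- exact: perp.1.
- exact: perp.2.
Qed.

Lemma quasi_inverse_idem (R : pzRingType) (u v e f : R) :
  quasi_inverse u v e f -> e * e = e /\ f * f = f.
Proof.
move=> q; split; apply/esym/eqP; rewrite -subr_eq0.
  by rewrite -{1}[e]mul1r -mulrBl -(qi_uv q) -mulrA (qi_ve q) mulr0.
by rewrite -{1}[f]mul1r -mulrBl -(qi_vu q) -mulrA (qi_uf q) mulr0.
Qed.

Lemma quasi_invertible_unitl (R : pzRingType) (p p' u : R) :
  p * p' = 1 -> p' * p = 1 -> quasi_invertible u -> quasi_invertible (p * u).
Proof.
move=> pp' p'p [c [d cd]]; exists (c * p'), (d * p').
have -> : 1 - p * u * (c * p') = p * (1 - u * c) * p'.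
  by rewrite mulrBr mulr1 mulrBl pp' !mulrA.
have -> : 1 - d * p' * (p * u) = 1 * (1 - d * u) * 1.
  by rewrite mul1r mulr1 mulrA (mulr_tail p'p) mulr1.
exact: ring_perpM.
Qed.

Lemma quasi_invertible_unitr (R : pzRingType) (p p' u : R) :
  p * p' = 1 -> p' * p = 1 -> quasi_invertible u -> quasi_invertible (u * p).
Proof.
move=> pp' p'p [c [d cd]]; exists (p' * c), (p' * d).
have -> : 1 - p' * d * (u * p) = p' * (1 - d * u) * p.
  by rewrite mulrBr mulr1 mulrBl p'p !mulrA.
have -> : 1 - u * p * (p' * c) = 1 * (1 - u * c) * 1.
  by rewrite mul1r mulr1 mulrA (mulr_tail pp') mulr1.
exact: ring_perpM.
Qed.

(* In a QB-ring, [c : f R -> g R] can be perturbed by [b] to a quasi-invertible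
   element of the skew corner [g R f], because [u : R -> R] has kernel [f R] and
   [w : R -> R] has cokernel [g R], so that [w * u + g * c * f] merges all three
   maps into a single element of [R]. *)
Lemma skew_corner_QB (R : pzRingType) (u v e f w z g h a b c : R) :
    QB_ring R -> quasi_inverse u v e f -> quasi_inverse w z g h ->
    a * (g * c * f) + b * f = f ->
  exists y k, f * k * g = k /\
    ring_perp (g - g * (c + y * b) * f * k) (f - k * (g * (c + y * b) * f)).
Proof.
move=> QB qu qw abf.
have [[_ ff] [gg _]] := (quasi_inverse_idem qu, quasi_inverse_idem qw).
have hz : h * z = 0 := qi_fv qw.
have zw : z * w = 1 - h := qi_vu qw.
(* [v * z] inverts [w * u] on the left up to [f] and [v * h * u], [a * g] acts on [g * c * f], and
   the cross terms die because [z * g = 0] and [g * w = 0]. *)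
have uni : (v * z + a * g) * (w * u + g * c * f) + (b * f + v * h * u) = 1.
  have -> : (v * z + a * g) * (w * u + g * c * f)
      = v * u - v * h * u + a * (g * c * f).
    rewrite mulrDl !mulrDr !mulrA (mulr_tail zw) (mulr_tail (qi_ve qw)).
    rewrite (mulr_tail (qi_eu qw)) (mulr_tail gg) mulrBr mulr1 mulrBl.
    by rewrite !mulr0 !mul0r addr0 add0r.
  rewrite -addrA [X in _ + X]addrA abf (addrC f) addrA subrK (qi_vu qu).
  by rewrite subrK.
(* The unipotent [1 - n] makes both one-sided corners [g * t] and [t * f] of the
   resulting quasi-invertible element equal to [g * (c + y * b) * f]. *)
have [y qt] := QB _ _ _ uni; pose n := v * z * y * b * f.
have nn : n * n = 0.
  by rewrite /n !mulrA (mulr_tail (qi_fv qu)) mulr0 !mul0r.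
have t'E : (w * u + g * c * f + y * (b * f + v * h * u)) * (1 - n)
    = w * u + g * (c + y * b) * f + y * v * h * u.
  (* Since [e R f = 0], the [v] in [n] cancels [u]; subtracting the result from [y * b * f] leaves
     [g * y * b * f]. *)
  have wun : w * u * n = w * z * (y * b * f).
    have -> : w * u * n = w * z * (y * b * f) - w * (e * (z * y * b) * f).
      by rewrite /n !mulrA (mulr_tail (qi_uv qu)) mulrBr mulr1 !mulrBl.
    by rewrite (qi_ef qu) mulr0 subr0.
  have fn x : x * f * n = 0.
    by rewrite /n !mulrA (mulr_tail (qi_fv qu)) mulr0 !mul0r.
  have hun : y * (v * h * u) * n = 0.
    have -> : y * (v * h * u) * n
        = y * v * (h * z) * (y * b * f) - y * v * h * (e * (z * y * b) * f).
      by rewrite /n !mulrA (mulr_tail (qi_uv qu)) mulrBr mulr1 !mulrBl.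
    by rewrite (qi_ef qu) hz !mulr0 mul0r subrr.
  clearbody n.
  rewrite mulrDr mulr1 mulrN (mulrDr y) !mulrDl wun hun !mulrA !fn !addr0.
  rewrite mulrDr mulrDl !mulrA (qi_uv qw) !mulrBl mul1r opprB !addrA.
  by rewrite [LHS](ACl (1*2*5*4*3*6))%AC /= addrK.
have {qt} : quasi_invertible (w * u + g * (c + y * b) * f + y * v * h * u).
  rewrite -t'E; apply: (@quasi_invertible_unitr _ _ (1 + n)) => //.
    by rewrite mulrBl mul1r mulrDr mulr1 nn addr0 addrK.
  by rewrite mulrBr mulr1 mulrDl mul1r nn addr0 addrK.
set c' := g * (c + y * b) * f; set t := _ + _ => qt.
have [s [k0 [l0 qs]]] := quasi_inverseP qt.
have gt : g * t = c'.
  have gyvh : g * y * v * h = 0 by rewrite -(mulrA g) (qi_ef qw).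
  by rewrite /t 2!(mulrDr g) !mulrA gyvh (qi_eu qw) !mul0r add0r addr0 gg.
have tf : t * f = c'.
  by rewrite /t !mulrDl !(mulr_tail (qi_uf qu)) !mulr0 add0r addr0 /c'
             (mulr_tail ff).
(* As [g * t = c' = t * f], the defects of [f * s * g] are corners of the defects of [s], hence
   still perpendicular. *)
have k1 : g - c' * (f * s * g) = g * (1 - t * s) * g.
  rewrite mulrBr mulr1 mulrBl gg !mulrA gt; congr (_ - _ * _ * _).
  by rewrite /c' (mulr_tail ff).
have k2 : f - f * s * g * c' = f * (1 - s * t) * f.
  rewrite mulrBr mulr1 mulrBl ff -!mulrA tf; congr (_ - _ * (_ * _)).
  by rewrite /c' !mulrA gg.
exists y, (f * s * g); split; first by rewrite !mulrA ff -mulrA gg.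
rewrite -/c' k1 k2; apply: ring_perpM.
rewrite (qi_uv qs) (qi_vu qs) !subKr.
by split; [exact: qi_ef qs | exact: qi_fe qs].
Qed.

(** * Moves on unimodular pairs *)

Definition unimodular_pair (R : pzRingType) (A B : R) : Prop :=
  exists X Z, X * A + Z * B = 1.

Definition QB_pair (R : pzRingType) (A B : R) : Prop :=
  unimodular_pair A B -> exists Y, quasi_invertible (A + Y * B).

Lemma QB_pair_quasi_invertible (R : pzRingType) (A B : R) :
  quasi_invertible A -> QB_pair A B.
Proof. by move=> q _; exists 0; rewrite mul0r addr0. Qed.

(** The free coefficient [Z] of a unimodular pair absorbs the term [X * P' * Y] that this move
    creates. *)
Lemma QB_pair_mull (R : pzRingType) (P P' Y A B : R) :
  P * P' = 1 -> P' * P = 1 -> QB_pair (P * A + Y * B) B -> QB_pair A B.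
Proof.
move=> PP' P'P QBp [X [Z XZ]].
have [|Y' q] := QBp.
  exists (X * P'), (Z - X * P' * Y); rewrite mulrDr mulrBl !mulrA.
  by rewrite (mulr_tail P'P) mulr1 addrACA subrr addr0.
exists (P' * (Y + Y')).
have -> : A + P' * (Y + Y') * B = P' * (P * A + Y * B + Y' * B).
  by rewrite mulrDr mulrDl !mulrDr !mulrA P'P mul1r addrA.
exact: quasi_invertible_unitl P'P PP' q.
Qed.

Lemma QB_pair_mulr (R : pzRingType) (Q Q' A B : R) :
  Q * Q' = 1 -> Q' * Q = 1 -> QB_pair (A * Q) (B * Q) -> QB_pair A B.
Proof.
move=> QQ' Q'Q QBp [X [Z XZ]].
have [|Y q] := QBp.
  exists (Q' * X), (Q' * Z).
  by rewrite -!mulrA -mulrDr !mulrA -mulrDl XZ mul1r.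
exists Y; have -> : A + Y * B = (A * Q + Y * (B * Q)) * Q'.
  by rewrite mulrDl !mulrA !(mulr_tail QQ') !mulr1.
exact: quasi_invertible_unitr Q'Q QQ' q.
Qed.

(** * Block matrices of size two and the doubling step *)

Section Blocks.
Variables (R : pzRingType) (m : nat).
Local Notation S := 'M[R]_m.
Local Notation T := 'M[R]_(m + m).
Implicit Types (a b c d u v w z e f g h k l x y : S) (B : T).

Definition blk a b c d : T := block_mx a b c d.

Lemma blkP B : exists a b c d, B = blk a b c d.
Proof.
exists (ulsubmx B), (ursubmx B), (dlsubmx B), (drsubmx B).
by rewrite /blk submxK.
Qed.

Lemma blk_inj a b c d a' b' c' d' :
  blk a b c d = blk a' b' c' d' -> [/\ a = a', b = b', c = c' & d = d'].
Proof. exact: eq_block_mx. Qed.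

Lemma blk1 : 1 = blk 1 0 0 1.
Proof. exact: scalar_mx_block. Qed.

Lemma blkM a b c d a' b' c' d' :
  blk a b c d * blk a' b' c' d'
  = blk (a * a' + b * c') (a * b' + b * d') (c * a' + d * c') (c * b' + d * d').
Proof. exact: mulmx_block. Qed.

Lemma blkD a b c d a' b' c' d' :
  blk a b c d + blk a' b' c' d' = blk (a + a') (b + b') (c + c') (d + d').
Proof. exact: add_block_mx. Qed.

Lemma blkN a b c d : - blk a b c d = blk (- a) (- b) (- c) (- d).
Proof. exact: opp_block_mx. Qed.

Let simp := (mul0r, mulr0, mul1r, mulr1, add0r, addr0, subr0, oppr0).

Lemma QB_pair_row1 x y y' a b c d b11 b12 b21 b22 :
    QB_pair (blk (a + x * c + (y * b11 + y' * b21))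
                 (b + x * d + (y * b12 + y' * b22)) c d)
            (blk b11 b12 b21 b22) ->
  QB_pair (blk a b c d) (blk b11 b12 b21 b22).
Proof.
move=> H.
apply: (@QB_pair_mull _ (blk 1 x 0 1) (blk 1 (- x) 0 1) (blk y y' 0 0)).
- by rewrite blkM !simp addNr -blk1.
- by rewrite blkM !simp subrr -blk1.
- by rewrite !blkM !simp blkD !simp.
Qed.

Lemma QB_pair_swap a b c d b11 b12 b21 b22 :
    QB_pair (blk d c b a) (blk b12 b11 b22 b21) ->
  QB_pair (blk a b c d) (blk b11 b12 b21 b22).
Proof.
move=> H; have ss : blk 0 1 1 0 * blk 0 1 1 0 = 1 by rewrite blkM !simp -blk1.
apply: (QB_pair_mull (Y := 0) ss ss); apply: (QB_pair_mulr ss ss).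
by rewrite !simp !blkM !simp.
Qed.

Lemma QB_pair_row2 x y y' a b c d b11 b12 b21 b22 :
    QB_pair (blk a b (c + x * a + (y * b11 + y' * b21))
                 (d + x * b + (y * b12 + y' * b22))) (blk b11 b12 b21 b22) ->
  QB_pair (blk a b c d) (blk b11 b12 b21 b22).
Proof.
move=> H; apply: QB_pair_swap; apply: (@QB_pair_row1 x y y').
exact: QB_pair_swap.
Qed.

(** A column operation also changes the second member of the pair, hence the quantification over
    [B']. *)
Lemma QB_pair_col2 x a b c d B :
    (forall B', QB_pair (blk a (b + a * x) c (d + c * x)) B') ->
  QB_pair (blk a b c d) B.
Proof.
move=> H; apply: (@QB_pair_mulr _ (blk 1 x 0 1) (blk 1 (- x) 0 1)).
- by rewrite blkM !simp addNr -blk1.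
- by rewrite blkM !simp subrr -blk1.
- by rewrite blkM !simp [a * x + b]addrC [c * x + d]addrC.
Qed.

Lemma QB_pair_col1 x a b c d B :
    (forall B', QB_pair (blk (a + b * x) b (c + d * x) d) B') ->
  QB_pair (blk a b c d) B.
Proof.
move=> H; apply: (@QB_pair_mulr _ (blk 1 0 x 1) (blk 1 0 (- x) 1)).
- by rewrite blkM !simp subrr -blk1.
- by rewrite blkM !simp addNr -blk1.
- by rewrite blkM !simp.
Qed.

Lemma QB_pair_rowadd1 x a b c d B :
  QB_pair (blk (a + x * c) (b + x * d) c d) B -> QB_pair (blk a b c d) B.
Proof.
have [b11 [b12 [b21 [b22 ->]]]] := blkP B => H.
by apply: (@QB_pair_row1 x 0 0); rewrite !simp.
Qed.

Lemma QB_pair_rowadd2 x a b c d B :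
  QB_pair (blk a b (c + x * a) (d + x * b)) B -> QB_pair (blk a b c d) B.
Proof.
have [b11 [b12 [b21 [b22 ->]]]] := blkP B => H.
by apply: (@QB_pair_row2 x 0 0); rewrite !simp.
Qed.

Lemma unimodular_col1 a b c d b11 b12 b21 b22 :
    unimodular_pair (blk a b c d) (blk b11 b12 b21 b22) ->
  exists x x' y y', x * a + x' * c + (y * b11 + y' * b21) = 1.
Proof.
move=> [X [Z]]; have [x [x' [x2 [x3 ->]]]] := blkP X.
have [y [y' [y2 [y3 ->]]]] := blkP Z.
by rewrite !blkM blkD blk1 => /blk_inj[? _ _ _]; exists x, x', y, y'.
Qed.

Lemma unimodular_col2 a b c d b11 b12 b21 b22 :
    unimodular_pair (blk a b c d) (blk b11 b12 b21 b22) ->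
  exists x x' y y', x * b + x' * d + (y * b12 + y' * b22) = 1.
Proof.
move=> [X [Z]]; have [x2 [x3 [x [x' ->]]]] := blkP X.
have [y2 [y3 [y [y' ->]]]] := blkP Z.
by rewrite !blkM blkD blk1 => /blk_inj[_ _ _ ?]; exists x, x', y, y'.
Qed.

Lemma quasi_invertible_blk u v e f w z g h b c k l :
    quasi_inverse u v e f -> quasi_inverse w z g h ->
    e * b * h = b -> g * c * f = c -> h * l * e = l -> f * k * g = k ->
    ring_perp (e - b * l) (h - l * b) -> ring_perp (g - c * k) (f - k * c) ->
  quasi_invertible (blk u b c w).
Proof.
move=> qu qw bE cE lE kE pb pc.
have [[ee ff] [gg hh]] := (quasi_inverse_idem qu, quasi_inverse_idem qw).
have bz : b * z = 0 by rewrite -bE -mulrA (qi_fv qw) mulr0.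
have cv : c * v = 0 by rewrite -cE -mulrA (qi_fv qu) mulr0.
have vb : v * b = 0 by rewrite -bE !mulrA (qi_ve qu) !mul0r.
have zc : z * c = 0 by rewrite -cE !mulrA (qi_ve qw) !mul0r.
have uk : u * k = 0 by rewrite -kE !mulrA (qi_uf qu) !mul0r.
have wl : w * l = 0 by rewrite -lE !mulrA (qi_uf qw) !mul0r.
have kw : k * w = 0 by rewrite -kE -mulrA (qi_eu qw) mulr0.
have lu : l * u = 0 by rewrite -lE -mulrA (qi_eu qu) mulr0.
have sub (p q : S) : 1 - (1 - p + q) = p - q.
  by rewrite opprD opprB addrA subrKC.
have E : 1 - blk u b c w * blk v k l z = blk (e - b * l) 0 0 (g - c * k).
  rewrite blkM bz cv uk wl !simp (qi_uv qu) (qi_uv qw) blk1 blkN blkD !simp.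
  by rewrite (addrC (c * k)) !sub.
have F : 1 - blk v k l z * blk u b c w = blk (f - k * c) 0 0 (h - l * b).
  rewrite blkM vb zc kw lu !simp (qi_vu qu) (qi_vu qw) blk1 blkN blkD !simp.
  by rewrite (addrC (l * b)) !sub.
exists (blk v k l z), (blk v k l z); rewrite E F.
(* Pulling the idempotents [e], [f], [g], [h] out of the defects reduces the entries not covered by
   [pb] and [pc] to [e R f = 0] and [g R h = 0]. *)
have idl (p p' x y : S) :
    p * p = p -> p * x * p' = x -> p - x * y = p * (1 - x * y).
  by move=> pp xE; rewrite mulrBr mulr1 mulrA -xE !mulrA pp.
have idr (p p' x y : S) :
    p * p = p -> p' * y * p = y -> p - x * y = (1 - x * y) * p.
  by move=> pp yE; rewrite mulrBl mul1r -yE -!mulrA pp.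
have sandwich (p q x y : S) : (forall r, p * r * q = 0) ->
    forall r, p * x * r * (y * q) = 0.
  by move=> pq r; rewrite -(pq (x * r * y)) !mulrA.
split=> r; have [r11 [r12 [r21 [r22 ->]]]] := blkP r; rewrite !blkM !simp.
  rewrite pb.1 pc.1 (idl e h b l) // (idr f g k c) // (idl g f c k) //.
  rewrite (idr h e l b) // (sandwich _ _ _ _ (qi_ef qu)).
  by rewrite (sandwich _ _ _ _ (qi_ef qw)) /blk block_mx0.
rewrite pb.2 pc.2 (idr e h b l) // (idl f g k c) // (idr g f c k) //.
rewrite (idl h e l b) // (sandwich _ _ _ _ (qi_fe qu)).
by rewrite (sandwich _ _ _ _ (qi_fe qw)) /blk block_mx0.
Qed.

(** Only the lower left entry changes: [v * s = 0] protects the lower right one from the clearing by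
    [u], and a unipotent factor restores [w]. *)
Lemma QB_pair_skew_corner u v e f w z g h s c B :
    QB_ring S -> quasi_inverse u v e f -> quasi_inverse w z g h -> v * s = 0 ->
    (forall c' k, g * c' * f = c' -> f * k * g = k ->
       ring_perp (g - c' * k) (f - k * c') -> QB_pair (blk u s c' w) B) ->
  QB_pair (blk u s (g * c * f) w) B.
Proof.
move=> QB qu qw vs H.
have [[_ ff] [gg _]] := (quasi_inverse_idem qu, quasi_inverse_idem qw).
have [b11 [b12 [b21 [b22 BE]]]] := blkP B; rewrite BE in H * => uni.
(* Right multiplication by [f] kills [x * u], leaving the relation that [skew_corner_QB] needs. *)
have [x [x' [y [y' /(congr1 ( *%R^~ f))]]]] := unimodular_col1 uni.
rewrite !mulrDl mul1r (mulr_tail (qi_uf qu)) mulr0 add0r -mulrA.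
rewrite (mulr_tail ff) -mulrDl => /(skew_corner_QB QB qu qw)[t [k [kE perp]]].
set r1 := y * b11 + y' * b21 in perp; pose r2 := y * b12 + y' * b22.
move: uni; apply: (@QB_pair_row2 0 (g * t * y) (g * t * y')).
rewrite !mul0r !addr0 -!(mulrA (g * t)) -!mulrDr -/r1 -/r2.
apply: (@QB_pair_rowadd2 (- (g * t * r1 * v))).
(* [g R h = 0] makes the perturbation of [w] a left multiple of [w]; the factor [1 + n] is unipotent
   and fixes [c'] because [z * g = 0]. *)
have -> : w + g * t * r2 + - (g * t * r1 * v) * s = (1 + g * t * r2 * z) * w.
  have gh0 : g * t * r2 * h = 0 by rewrite -(mulrA g) (qi_ef qw).
  rewrite mulNr (mulr_tail vs) mulr0 subr0 mulrDl mul1r (mulr_tail (qi_vu qw)).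
  by rewrite mulrBr mulr1 gh0 subr0.
have -> : g * c * f + g * t * r1 + - (g * t * r1 * v) * u
    = g * (c + t * r1) * f.
  rewrite mulNr (mulr_tail (qi_vu qu)) mulrBr mulr1 opprB.
  by clearbody r1; rewrite -addrA [X in _ + X]addrC subrK mulrDr mulrDl !mulrA.
set c' := g * (c + t * r1) * f in perp *; set n := g * t * r2 * z.
have n0 p : n * (g * p) = 0.
  by rewrite /n mulrA (mulr_tail (qi_ve qw)) mulr0 mul0r.
have nn : n * n = 0 by rewrite {2}/n -!(mulrA g) n0.
have n1 : (1 - n) * (1 + n) = 1.
  by rewrite mulrDr mulr1 mulrBl mul1r nn subr0 subrK.
have n2 : (1 + n) * (1 - n) = 1.
  by rewrite mulrBr mulr1 mulrDl mul1r nn addr0 addrK.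
apply: (@QB_pair_mull _ (blk 1 0 0 (1 - n)) (blk 1 0 0 (1 + n)) 0).
- by rewrite blkM !simp n1 -blk1.
- by rewrite blkM !simp n2 -blk1.
have nc : (1 - n) * c' = c' by rewrite mulrBl mul1r /c' -mulrA n0 subr0.
rewrite blkM !simp nc mulrA n1 mul1r; apply: H kE perp.
by rewrite /c' !mulrA gg (mulr_tail ff).
Qed.

(** The skew corner step is applied to the lower left entry and then, after swapping rows and
    columns, to the other one; the entry already treated survives. *)
Lemma QB_pair_diagonal u v e f w z g h b c B :
    QB_ring S -> quasi_inverse u v e f -> quasi_inverse w z g h ->
  QB_pair (blk u (e * b * h) (g * c * f) w) B.
Proof.
move=> QB qu qw; apply: (QB_pair_skew_corner QB qu qw).
  by rewrite !mulrA (qi_ve qu) !mul0r.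
move=> c' k c'E kE pc.
have [b11 [b12 [b21 [b22 ->]]]] := blkP B; apply: QB_pair_swap.
apply: (QB_pair_skew_corner QB qw qu).
  by rewrite -c'E !mulrA (qi_ve qw) !mul0r.
move=> b' l b'E lE pb; apply: QB_pair_quasi_invertible.
exact: quasi_invertible_blk qw qu c'E b'E kE lE pc pb.
Qed.

Lemma QB_pair_first_column u v e f b c d B :
  QB_ring S -> quasi_inverse u v e f -> QB_pair (blk u (e * b) c d) B.
Proof.
move=> QB qu; have ee := (quasi_inverse_idem qu).1.
have [b11 [b12 [b21 [b22 ->]]]] := blkP B => uni.
have [x [x' [y [y']]]] := unimodular_col2 uni.
rewrite (addrC (x * _)) -addrA => xy.
have [t /quasi_inverseP[z [g [h qw]]]] := QB _ _ _ xy.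
move: uni; apply: (@QB_pair_row2 (t * (x * e)) (t * y) (t * y')).
have -> : d + t * (x * e) * (e * b) + (t * y * b12 + t * y' * b22)
    = d + t * (x * (e * b) + (y * b12 + y' * b22)).
  by rewrite !mulrDr !mulrA (mulr_tail ee) !addrA.
set w := d + _ in qw *; set c' := c + _ + _.
clearbody w c'.
(* Three clearing moves cut the off-diagonal entries down to [g R f] and [e R h]; [v * e = 0] and
   [e R f = 0] keep [u] and [w] intact. *)
apply: (QB_pair_rowadd2 (x := - (c' * v))).
have -> : c' + - (c' * v) * u = c' * f.
  by rewrite mulNr (mulr_tail (qi_vu qu)) mulrBr mulr1 subKr.
have -> : w + - (c' * v) * (e * b) = w.
  by rewrite mulNr mulrA (mulr_tail (qi_ve qu)) mulr0 mul0r subr0.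
have ef0 p q : e * p * (q * f) = 0 by rewrite mulrA -(mulrA e) (qi_ef qu).
apply: (QB_pair_col1 (x := - (z * c' * f))) => B2.
have -> : u + e * b * - (z * c' * f) = u by rewrite mulrN ef0 subr0.
have -> : c' * f + w * - (z * c' * f) = g * c' * f.
  by rewrite mulrN !mulrA (qi_uv qw) !mulrBl mul1r subKr.
apply: (QB_pair_rowadd1 (x := - (e * b * z))).
have -> : u + - (e * b * z) * (g * c' * f) = u.
  by rewrite mulNr -(mulrA e) ef0 subr0.
have -> : e * b + - (e * b * z) * w = e * b * h.
  by rewrite mulNr (mulr_tail (qi_vu qw)) mulrBr mulr1 subKr.
exact: QB_pair_diagonal QB qu qw.
Qed.

Lemma QB_ring_double : QB_ring S -> QB_ring T.
Proof.
move=> QB A B X XAB.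
suff pair (A' B' : T) : QB_pair A' B'.
  by apply: pair; exists X, 1; rewrite mul1r.
have [a [b [c [d ->]]]] := blkP A'; have [b11 [b12 [b21 [b22 ->]]]] := blkP B'.
move=> uni; have [x [x' [y [y' xy]]]] := unimodular_col1 uni.
rewrite -addrA in xy; have [t /quasi_inverseP[v [e [f qu]]]] := QB _ _ _ xy.
move: uni; apply: (@QB_pair_row1 (t * x') (t * y) (t * y')).
rewrite -!(mulrA t) -!mulrDr -addrA -mulrDr.
set u := a + _ in qu *; set b' := b + _ + _.
apply: (QB_pair_col2 (x := - (v * b'))) => B1.
have -> : b' + u * - (v * b') = e * b'.
  by rewrite mulrN mulrA (qi_uv qu) mulrBl mul1r subKr.
exact: QB_pair_first_column QB qu.
Qed.
End Blocks.

(** * Corners and arbitrary sizes *)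

Lemma QB_ring_corner (R : pzRingType) (n k : nat) :
  QB_ring 'M[R]_(n + k) -> QB_ring 'M[R]_n.
Proof.
move=> QB A B X XAB.
(* Padding [A] with the identity and [B] with zero confines the perturbation to the first block
   column. *)
have [|Y] := QB (block_mx A 0 0 1%:M) (block_mx B 0 0 0) (block_mx X 0 0 1%:M).
  rewrite -mulmxE mulmx_block add_block_mx.
  rewrite !(mulmx0, mul0mx, mul1mx, addr0, add0r).
  by rewrite mulmxE XAB -[1]/(1%:M) -scalar_mx_block.
rewrite -(submxK Y); set y := ulsubmx Y; set r := dlsubmx Y *m B.
rewrite -mulmxE mulmx_block !mulmx0 !addr0 add_block_mx !addr0 !add0r -/r => q.
exists y; set s := A + y * B in q *.
pose N p : 'M[R]_(n + k) := block_mx 1%:M 0 p 1%:M.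
have NN p : N p * N (- p) = 1.
  rewrite -mulmxE mulmx_block !(mulmx0, mul0mx, mul1mx, mulmx1, addr0, add0r).
  by rewrite subrr -scalar_mx_block.
have NN' : N (- r) * N r = 1 by rewrite -{2}[r]opprK NN.
have := quasi_invertible_unitr NN' (NN r) q.
have -> : block_mx s 0 r 1%:M * N (- r) = block_mx s 0 0 1%:M.
  rewrite -mulmxE mulmx_block !(mulmx0, mul0mx, mul1mx, mulmx1, addr0, add0r).
  by rewrite subrr.
move=> [c [d [cd dc]]]; exists (ulsubmx c), (ulsubmx d).
have ul1 : 1 = block_mx 1%:M 0 0 1%:M :> 'M[R]_(n + k) := scalar_mx_block n k 1.
have E : ulsubmx (1 - block_mx s 0 0 1%:M * c) = 1 - s * ulsubmx c.
  rewrite -{1}(submxK c) -!mulmxE mulmx_block ul1 opp_block_mx add_block_mx.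
  by rewrite block_mxKul mul0mx addr0.
have F : ulsubmx (1 - d * block_mx s 0 0 1%:M) = 1 - ulsubmx d * s.
  rewrite -{1}(submxK d) -!mulmxE mulmx_block ul1 opp_block_mx add_block_mx.
  by rewrite block_mxKul mulmx0 addr0.
(* Padding [p] with zeros turns a product of corners into the corner of a product, so
   perpendicularity descends. *)
have ulM (M M' : 'M[R]_(n + k)) p :
    ulsubmx M * p * ulsubmx M' = ulsubmx (M * block_mx p 0 0 0 * M').
  rewrite -{2}(submxK M) -{2}(submxK M') -!mulmxE !mulmx_block block_mxKul.
  by rewrite !(mulmx0, mul0mx, addr0).
rewrite -E -F; split=> p; rewrite ulM.
  by rewrite cd; apply/matrixP=> i j; rewrite !mxE.
by rewrite dc; apply/matrixP=> i j; rewrite !mxE.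
Qed.

Lemma QB_ring_mx1 (R : pzRingType) : QB_ring R -> QB_ring 'M[R]_1.
Proof.
move=> QB A B X /(congr1 (fun M : 'M_1 => M 0 0)).
rewrite !mxE big_ord1 => /QB[y [c [d [cd dc]]]].
have mx1 (M : 'M[R]_1) : M = (M 0 0)%:M := mx11_scalar M.
exists y%:M, c%:M, d%:M; split=> r; apply/matrixP=> i j; rewrite !ord1.
  have := cd (r 0 0).
  by rewrite !(mxE, big_ord1) /= !mulr1n.
have := dc (r 0 0).
by rewrite !(mxE, big_ord1) /= !mulr1n.
Qed.

Theorem theorem6p4 (R : pzRingType) (n : nat) (hn : (1 <= n)%N)
    (hR : QB_ring R) : QB_ring 'M[R]_n.
Proof.
have QB2 k : QB_ring 'M[R]_(2 ^ k).
  elim: k => [|k IH]; first exact: QB_ring_mx1.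
  by rewrite expnS mul2n -addnn; apply: QB_ring_double.
(* Since [n < 2 ^ n], the exponent [n] itself gives a large enough matrix ring. *)
apply: (@QB_ring_corner _ _ (2 ^ n - n)).
by rewrite subnKC //; apply/ltnW/ltn_expl.
Qed.
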